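(* Let $Z,S$ be finite alphabets with $|Z|\le|S|$, let $\tau\colon S\to Z$ be a surjective map, and let $\sigma\colon\Sigma_{Z,S}\to\Sigma_{Z,S}$ be the associated full zip shift map. Let $X\subset\Sigma_{Z,S}$ be a closed subset such that $\sigma(X)=X$. Then there does not exist a sequence $\alpha$ such that the restricted map $\sigma|_X\colon X\to X$ is topologically conjugate to the bilateral adding machine map $f_\alpha\colon\Delta_\alpha\to\Delta_\alpha$.
   Context: Zip space and zip shift: given finite alphabets $Z,S$ and a surjective map (transition map) $\tau\colon S\to Z$, $\Sigma_{Z,S}$ is the set of all bi-infinite sequences $x=(x_i)_{i\in\mathbb{Z}}$ with $x_i\in S$ for $i\ge 0$ and $x_i\in Z$ for $i<0$. It carries the metric $d(x,x)=0$ and $d(x,y)=2^{-M(x,y)}$ for $x\neq y$, where $M(x,y)=\min\{|i| : x_i\ne y_i,\ i\in\mathbb{Z}\}$. The zip shift map is $(\sigma(x))_i=x_{i+1}$ if $i\ne -1$ and $(\sigma(x))_{-1}=\tau(x_0)$. Bilateral adding machine: here $\alpha$ ranges over sequences $\alpha=(\ldots,2,2;j,j,\ldots)$ with $j\ge 2$ an integer, together with a surjective map $\tau'\colon\{0,\dots,j-1\}\to\{a_0,b_1\}$, where $a_0,b_1$ are identified with $0,1$. The space $\Delta_\alpha=\Sigma_{\{a_0,b_1\},\{0,\dots,j-1\}}$ is the set of all bi-infinite sequences with $x_i\in\{0,\dots,j-1\}$ for $i\ge 0$ and $x_i\in\{a_0,b_1\}$ for $i<0$, with the same type of metric $d$.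 Addition on $\Delta_\alpha$: $z=x+y$ is defined as follows. Nonnegative side: put $t_0=0$ and, for $i\ge 0$, $z_i=(x_i+y_i+t_i)\bmod j$, where $t_{i+1}=1$ if $x_i+y_i+t_i\ge j$ and $t_{i+1}=0$ otherwise. Negative side: put $s_1=\tau'((x_0+y_0)\bmod j)$ and, for $i\ge 1$, $z_{-i}=(x_{-i}+y_{-i}+s_i)\bmod 2$, where $s_{i+1}=b_1=1$ if $x_{-i}+y_{-i}+s_i\ge 2$ and $s_{i+1}=a_0=0$ otherwise. The map is $f_\alpha(x)=x+(\ldots,a_0,a_0;1,0,0,0,\ldots)$. Topological conjugacy of $\sigma|_X$ and $f_\alpha$ means existence of a homeomorphism $h\colon X\to\Delta_\alpha$ with $h\circ\sigma|_X=f_\alpha\circ h$. *)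

(* Defs.v *)
From HB Require Import structures.
From mathcomp Require Import all_boot all_order all_algebra.
From mathcomp Require Import all_classical all_reals all_analysis.

Set Implicit Arguments.
Unset Strict Implicit.
Unset Printing Implicit Defensive.

Import Order.TTheory GRing.Theory Num.Theory.

Local Open Scope classical_set_scope.

(* In [int], [Posz n] is n and [Negz n] is - (n + 1). *)
Definition zip_letter (Z S : Type) (i : int) : Type :=
  match i with Posz _ => S | Negz _ => Z end.

(* The phantom argument [R] is the real line in which the metric takes its
   values; it is what lets the metric be attached to the type. *)
Definition zip_space (R : realType) (Z S : finType) : Type :=
  forall i : int, zip_letter Z S i.

Section ZipMetric.
Context (R : realType) (Z S : finType).
Implicit Types x y z : zip_space R Z S.

Definition differ_at x y : pred nat :=
  fun n => `[< exists2 i : int, `|i|%N = n & x i <> y i >].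

Lemma differ_ex x y : x <> y -> exists n, differ_at x y n.
Proof.
move=> xy; apply: contrapT => nex; apply: xy.
apply: functional_extensionality_dep => i; apply: contrapT => xyi.
by apply: nex; exists `|i|%N; apply/asboolP; exists i.
Qed.

(* M(x, y) = min {|i| : x_i <> y_i} *)
Definition first_diff x y (xy : x <> y) : nat := ex_minn (differ_ex xy).

Local Open Scope ring_scope.

Definition zip_dist x y : R :=
  match pselect (x = y) with
  | left _ => 0
  | right xy => 2 ^- first_diff xy
  end.

Lemma zip_distxx x : zip_dist x x = 0.
Proof. by rewrite /zip_dist; case: pselect. Qed.

Lemma zip_dist_ge0 x y : 0 <= zip_dist x y.
Proof. by rewrite /zip_dist; case: pselect => // xy; rewrite invr_ge0 exprn_ge0. Qed.

Lemma zip_dist_positivity x y : zip_dist x y = 0 -> x = y.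
Proof.
rewrite /zip_dist; case: pselect => // xy /eqP.
by rewrite invr_eq0 expf_eq0 pnatr_eq0 andbF.
Qed.

Lemma differ_atC x y : differ_at x y = differ_at y x.
Proof.
apply/funext => n; apply/asboolP/asboolP => -[i ni xyi];
  by exists i => // /esym.
Qed.

Lemma zip_dist_sym x y : zip_dist x y = zip_dist y x.
Proof.
rewrite /zip_dist; case: pselect => [xy|xy]; case: pselect => [yx|yx] //.
- by case: yx.
- by case: xy.
congr (2 ^- _); rewrite /first_diff.
case: ex_minnP => m dm minm; case: ex_minnP => n dn minn.
by apply/eqP; rewrite eqn_leq minm ?minn // differ_atC.
Qed.

Lemma zip_dist_triangle y x z : zip_dist x z <= zip_dist x y + zip_dist y z.
Proof.
have le m n : (m <= n)%N -> (2 : R) ^- n <= 2 ^- m.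
  by move=> mn; rewrite lef_pV2 ?posrE ?exprn_gt0 // ler_eXn2l ?ltr1n.
rewrite {1}/zip_dist; case: pselect => [_|xz].
  by rewrite addr_ge0 // zip_dist_ge0.
rewrite /first_diff; case: ex_minnP => n /asboolP[i ni xzi] _.
have [xyi|xyi] := pselect (x i = y i).
- apply: (@le_trans _ _ (zip_dist y z)); last by rewrite lerDr zip_dist_ge0.
  rewrite /zip_dist; case: pselect => [yz|yz].
    by case: xzi; rewrite xyi yz.
  apply: le; rewrite /first_diff; case: ex_minnP => m _; apply.
  by apply/asboolP; exists i => //; rewrite -xyi.
- apply: (@le_trans _ _ (zip_dist x y)); last by rewrite lerDl zip_dist_ge0.
  rewrite /zip_dist; case: pselect => [xy|xy].
    by case: xyi; rewrite xy.
  apply: le; rewrite /first_diff; case: ex_minnP => m _; apply.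
  by apply/asboolP; exists i.
Qed.

HB.instance Definition _ := gen_eqMixin (zip_space R Z S).
HB.instance Definition _ := gen_choiceMixin (zip_space R Z S).
HB.instance Definition _ := isMetric.Build R (zip_space R Z S)
  zip_distxx zip_dist_positivity zip_dist_sym zip_dist_triangle.

(* (sigma x)_i = x_(i + 1) for i <> -1, and (sigma x)_(-1) = tau x_0 *)
Definition zip_shift (tau : S -> Z) (x : zip_space R Z S) : zip_space R Z S :=
  fun i => match i return zip_letter Z S i with
  | Posz n => x (Posz n.+1)
  | Negz 0 => tau (x (Posz 0))
  | Negz n.+1 => x (Negz n)
  end.

End ZipMetric.

(* The sequence alpha = (..., 2, 2; j, j, ...) together with its map tau';
   the letters a_0, b_1 are the elements 0, 1 of 'I_2. *)
Record adding_seq := AddingSeq {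
  adding_base : nat ;
  adding_base_ge2 : 2 <= adding_base ;
  adding_tau : 'I_adding_base -> 'I_2 ;
  adding_tau_surj : set_surj [set: 'I_adding_base] [set: 'I_2] adding_tau
}.

Definition adding_space (R : realType) (alpha : adding_seq) : Type :=
  zip_space R 'I_2 'I_(adding_base alpha).

HB.instance Definition _ (R : realType) (alpha : adding_seq) :=
  Metric.on (adding_space R alpha).

Section AddingMachine.
Context (R : realType) (alpha : adding_seq).
Local Notation j := (adding_base alpha).
Implicit Types x y : adding_space R alpha.

Lemma adding_base_gt0 : 0 < j.
Proof. exact: ltnW (adding_base_ge2 alpha). Qed.

Definition mod_base (n : nat) : 'I_j := Ordinal (ltn_pmod n adding_base_gt0).
Definition mod_two (n : nat) : 'I_2 := Ordinal (ltn_pmod n (ltn0Sn 1)).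

(* [pos_digit x i] is x_i, and [neg_digit x k] is x_(-(k + 1)). *)
Definition pos_digit x (i : nat) : 'I_j := x (Posz i).
Definition neg_digit x (k : nat) : 'I_2 := x (Negz k).

(* t_i *)
Fixpoint pos_carry x y (i : nat) : nat :=
  if i is i'.+1
  then nat_of_bool (j <= pos_digit x i' + pos_digit y i' + pos_carry x y i')
  else 0.

(* [neg_carry x y k] is s_(k + 1), the carry used at position -(k + 1). *)
Fixpoint neg_carry x y (k : nat) : nat :=
  if k is k'.+1
  then nat_of_bool (2 <= neg_digit x k' + neg_digit y k' + neg_carry x y k')
  else adding_tau (mod_base (pos_digit x 0 + pos_digit y 0)).

Definition adding_add x y : adding_space R alpha :=
  fun i => match i return zip_letter 'I_2 'I_j i with
  | Posz n => mod_base (pos_digit x n + pos_digit y n + pos_carry x y n)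
  | Negz k => mod_two (neg_digit x k + neg_digit y k + neg_carry x y k)
  end.

(* (..., a_0, a_0; 1, 0, 0, ...) *)
Definition adding_one : adding_space R alpha :=
  fun i => match i return zip_letter 'I_2 'I_j i with
  | Posz n => mod_base (n == 0)
  | Negz _ => mod_two 0
  end.

Definition adding_machine x : adding_space R alpha := adding_add x adding_one.

End AddingMachine.

(* Homeomorphism between the subspaces X and Y, represented by functions on the
   ambient spaces whose values outside X and Y are irrelevant. *)
Definition homeomorphism_on (T U : topologicalType) (X : set T) (Y : set U)
    (h : T -> U) : Prop :=
  [/\ set_bij X Y h, {within X, continuous h} &
      exists k : U -> T, {within Y, continuous k} /\ {in X, cancel h k}].

Definition topologically_conjugate (T U : topologicalType) (X : set T)
    (Y : set U) (f : T -> T) (g : U -> U) : Prop :=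
  exists h : T -> U,
    homeomorphism_on X Y h /\ forall x, X x -> h (f x) = g (h x).

(* Main.v *)
(* Let k be the inverse of the conjugacy. On the adding machine, agreement of
   two points on the window -N <= i < N is both preserved and reflected by every
   iterate. By compactness, (k a)_0 depends only on the window of a for some N.
   So if a <> b agree on that window, the 0-th letters of the images under k
   agree along whole forward and backward orbits of a and b. Forward, these
   letters are the nonnegative coordinates of k a and k b; backward, their
   images under tau are the negative ones. Hence k a = k b, which is absurd: an
   equicontinuous system without isolated points is not expansive. *)
Require Import Defs.
From HB Require Import structures.
From mathcomp Require Import all_boot all_order all_algebra.
From mathcomp Require Import all_classical all_reals all_analysis.

Set Implicit Arguments.
Unset Strict Implicit.
Unset Printing Implicit Defensive.

Import Order.TTheory GRing.Theory Num.Theory.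

Local Open Scope classical_set_scope.

Section ZipSpace.
Context (R : realType) (Z S : finType).
Implicit Types x y : zip_space R Z S.

(** Position n is paired with -(n+1), so that each stage of an induction on [N] adds one digit on
    either side. *)
Definition agree N x y :=
  forall n, n < N -> x (Posz n) = y (Posz n) /\ x (Negz n) = y (Negz n).

Lemma zip_dist_lt x (e : R) : (0 < e)%R ->
  exists N, forall y, agree N x y -> (zip_dist x y < e)%R.
Proof.
move=> e0; have [N Ne] : exists N, ((2 : R) ^- N < e)%R.
  (* With N the integer part of 1/e, one has 1/e < N + 1 <= 2^N. *)
  exists (Num.truncn e^-1).
  rewrite invf_plt ?posrE ?exprn_gt0 //.
  apply: lt_le_trans (truncnS_gt _) _.
  by rewrite -natrX ler_nat ltn_expl.
exists N => y xy; rewrite /zip_dist; case: pselect => // nxy.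
apply: le_lt_trans _ Ne.
rewrite /Defs.first_diff; case: ex_minnP => M /asboolP[i iM xyi] _.
rewrite lef_pV2 ?posrE ?exprn_gt0 //.
rewrite ler_eXn2l ?ltr1n //.
rewrite leqNgt; apply/negP => MN; apply: xyi; move: iM.
case: i => n /= nM; first by have [] := xy n; rewrite // nM.
by have [] := xy n; rewrite // (leq_trans _ MN) // -nM.
Qed.

(** A difference at index 0 would put the points at distance exactly 1. *)
Lemma zip_dist_lt1 x y : (zip_dist x y < 1)%R -> x (Posz 0) = y (Posz 0).
Proof.
rewrite /zip_dist; case: pselect => [-> //|nxy].
rewrite /Defs.first_diff; case: ex_minnP => -[|M] _ Mmin.
  by rewrite expr0 invr1 ltxx.
move=> _; apply: contrapT => xy0.
have /Mmin // : differ_at x y 0 by apply/asboolP; exists (Posz 0).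
Qed.

HB.instance Definition _ i := gen_eqMixin (zip_letter Z S i).
HB.instance Definition _ i := gen_choiceMixin (zip_letter Z S i).

Definition discrete_letter i : topologicalType :=
  discrete_topology (zip_letter Z S i).

Lemma compact_discrete_letter i : compact [set: discrete_letter i].
Proof.
by apply: finite_compact; case: i => n; apply: finite_finset.
Qed.

(* Bundled, since the [Filter] instance of [nbhs x] is not inferred for
   [x : prod_topology discrete_letter]. *)
Definition letter_space : topologicalType := prod_topology discrete_letter.

Lemma nbhs_letter (i : int) (x : letter_space) :
  nbhs x [set y : letter_space | x i = y i].
Proof.
have xi : nbhs (proj i x) [set x i] by exact: discrete_set1.
have pi : nbhs x (proj i @^-1` [set x i]).
  exact: (@proj_continuous _ discrete_letter i x _ xi).
by apply: filterS pi => y; exact: esym.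
Qed.

Lemma nbhs_agree N (x : letter_space) :
  nbhs x [set y : letter_space | agree N x y].
Proof.
elim: N => [|N IH]; first by apply: filterS filterT => y _ n.
apply: filterS3 IH (nbhs_letter (Posz N) x) (nbhs_letter (Negz N) x).
move=> y xy xyN xyN' n.
by rewrite ltnS leq_eqVlt => /predU1P[->|/xy].
Qed.

(** Read as a product of finite discrete spaces, [zip_space] is compact by Tychonoff and windows are
    neighbourhoods, so the local window sizes can be made uniform. *)
Lemma locally_constant_agree (T : Type) (g : zip_space R Z S -> T) :
  (forall x, exists N, forall y, agree N x y -> g x = g y) ->
  exists N, forall x y, agree N x y -> g x = g y.
Proof.
move=> gloc.
have /compact_near_coveringP cov := tychonoff compact_discrete_letter.
pose P N (x : letter_space) := forall y, agree N x y -> g x = g y.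
have [|N _ /(_ N (leqnn N)) NP] := cov nat \oo P _.
  move=> x _; have [N gN] := gloc x.
  (* If x' agrees with x on the window N, and y with x' on a window n >= N, then y agrees with x on
     the window N: both values are [g x]. *)
  exists ([set y : letter_space | agree N x y], [set n | N <= n]).
    by split; [exact: nbhs_agree | exists N].
  move=> [x' n] [/= xx' Nn] y x'y; rewrite -(gN _ xx'); apply: gN => m mN.
  have [-> ->] := xx' m mN; exact: x'y (leq_trans mN Nn).
by exists N => x y; apply: NP.
Qed.

Lemma iter_zip_shift_pos (tau : S -> Z) x n :
  iter n (zip_shift tau) x (Posz 0) = x (Posz n).
Proof.
suff {n} H n i : iter n (zip_shift tau) x (Posz i) = x (Posz (n + i)).
  by rewrite H addn0.
by elim: n i => //= n IH i; rewrite IH addnS.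
Qed.

(** The first shift takes x_0 across the origin through [tau]; the other n only move it left. *)
Lemma iter_zip_shift_neg (tau : S -> Z) x n :
  iter n.+1 (zip_shift tau) x (Negz n) = tau (x (Posz 0)).
Proof. by rewrite iterSr; elim: n => //= n IH. Qed.

End ZipSpace.

Section Adding.
Context (R : realType) (alpha : adding_seq).
Local Notation agree := (@agree R 'I_2 'I_(adding_base alpha)).
Implicit Types x y z : adding_space R alpha.

Lemma mod_base_addIr (a b : 'I_(adding_base alpha)) c :
  mod_base alpha (a + c) = mod_base alpha (b + c) -> a = b.
Proof.
move=> /(congr1 val) /= /eqP; rewrite eqn_modDr !modn_small // => /eqP.
exact: val_inj.
Qed.

Lemma mod_two_addIr (a b : 'I_2) c : mod_two (a + c) = mod_two (b + c) -> a = b.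
Proof.
move=> /(congr1 val) /= /eqP; rewrite eqn_modDr !modn_small // => /eqP.
exact: val_inj.
Qed.

Lemma pos_carry_agree N x y z n : agree N x y -> n <= N ->
  pos_carry x z n = pos_carry y z n.
Proof.
move=> xy; elim: n => //= n IH nN.
by rewrite /pos_digit (xy n nN).1 IH // ltnW.
Qed.

(** [0 < N] enters because the initial negative carry reads the digits at 0. *)
Lemma neg_carry_agree N x y z n : agree N x y -> 0 < N -> n <= N ->
  neg_carry x z n = neg_carry y z n.
Proof.
move=> xy N0; elim: n => [|n IH] /= nN; first by rewrite /pos_digit (xy 0 N0).1.
by rewrite /neg_digit (xy n nN).2 IH // ltnW.
Qed.

(** Each carry depends only on digits nearer the origin or at 0, so z can be cancelled digit by
    digit, going outward. *)
Lemma agree_adding_add N x y z :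
  agree N (adding_add x z) (adding_add y z) <-> agree N x y.
Proof.
split=> [xy|xy n nN]; last first.
  have N0 : 0 < N by exact: leq_trans nN.
  rewrite /adding_add /pos_digit /neg_digit (xy n nN).1 (xy n nN).2.
  rewrite (pos_carry_agree z xy (ltnW nN)).
  by rewrite (neg_carry_agree z xy N0 (ltnW nN)).
suff H M : M <= N -> agree M x y by exact: H.
elim: M => [_ n //|M IH MN n].
rewrite ltnS leq_eqVlt => /predU1P[->|]; last by apply: IH; exact: ltnW.
have {}IH := IH (ltnW MN); have [+ +] := xy M MN.
rewrite /adding_add (pos_carry_agree z IH (leqnn M)) -!addnA.
move=> /mod_base_addIr xyM.
suff -> : neg_carry x z M = neg_carry y z M by move=> /mod_two_addIr.
(* For M = 0 this carry comes from the digit at 0, just shown equal; otherwise from the window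
   already treated. *)
case: M => [|M] in MN IH xyM *; first by rewrite /= xyM.
exact: neg_carry_agree IH _ _.
Qed.

Lemma agree_iter_adding_machine N n x y :
  agree N (iter n (@adding_machine R alpha) x)
          (iter n (@adding_machine R alpha) y)
  <-> agree N x y.
Proof.
by elim: n => //= n IH; rewrite /adding_machine agree_adding_add.
Qed.

Lemma agree_distinct N : exists x y, agree N x y /\ x <> y.
Proof.
(* A single 1 at position n, distinct from the digit 0 because the base is at least 2. *)
pose w n : adding_space R alpha := fun i =>
  match i return zip_letter 'I_2 'I_(adding_base alpha) i with
  | Posz m => mod_base alpha (m == n)
  | Negz _ => mod_two 0
  end.
exists (w N), (w N.+1); split.
  by move=> n nN; rewrite /w !ltn_eqF // ltnW.
move=> /(congr1 (fun x : adding_space R alpha => val (pos_digit x N))).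
by rewrite /pos_digit /= eqxx ltn_eqF // mod0n modn_small // adding_base_ge2.
Qed.

End Adding.

Theorem proposition2p26 (R : realType) (Z S : finType) (leZS : #|Z| <= #|S|)
    (tau : S -> Z) (tau_surj : set_surj [set: S] [set: Z] tau)
    (X : set (zip_space R Z S)) (X_closed : closed X)
    (X_inv : zip_shift tau @` X = X) :
  ~ exists alpha : adding_seq,
      topologically_conjugate X [set: adding_space R alpha]
        (zip_shift tau) (@adding_machine R alpha).
Proof.
move=> [alpha [h [[[hX _ hsurj] _ [k [kcont hK]]] hf]]].
set f := @adding_machine R alpha in hf *.
have sX x : X x -> X (zip_shift tau x) by move=> Xx; rewrite -X_inv; exists x.
have hP u : exists2 x, X x & h x = u by exact: (hsurj u I).
have kX u : h (k u) = u.
  by have [x Xx <-] := hP u; rewrite hK // inE.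
have kf u : k (f u) = zip_shift tau (k u).
  have [x Xx <-] := hP u.
  by rewrite -hf // !hK // inE //; exact: sX.
have kfn n u : k (iter n f u) = iter n (zip_shift tau) (k u).
  by elim: n => //= n IH; rewrite kf IH.
(* Surjectivity of [f] is transported from sigma(X) = X; it provides the backward orbits. *)
have fsurj u : exists v, f v = u.
  have [x + <-] := hP u; rewrite -X_inv => -[y Xy <-].
  by exists (h y); rewrite hf.
have fnsurj n u : exists v, iter n f v = u.
  elim: n u => [u|n IH u]; first by exists u.
  by have [v <-] := fsurj u; have [w <-] := IH v; exists w.
have kc : continuous k by exact/continuous_subspace_setT.
have [|N kN] := @locally_constant_agree R _ _ _
  (fun u : adding_space R alpha => k u (Posz 0)).
  move=> u.
  have /(kc u) /nbhs_ballP[e /= e0 ke] := nbhsx_ballx (k u) 1%R ltr01.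
  have [N uN] := zip_dist_lt u e0.
  by exists N => v uv; exact: zip_dist_lt1 (ke v (uN v uv)).
have [a [b [ab]]] := agree_distinct R alpha N; apply.
rewrite -(kX a) -(kX b); congr h.
apply: functional_extensionality_dep => -[n|n].
  rewrite -(iter_zip_shift_pos tau (k a)) -(iter_zip_shift_pos tau (k b)).
  rewrite -2!kfn; apply: kN.
  exact/agree_iter_adding_machine.
(* The letter at -(n+1) is [tau] of the 0-th letter n+1 steps earlier, and agreement passes back to
   any chosen preimages. *)
have [a' a'E] := fnsurj n.+1 a; have [b' b'E] := fnsurj n.+1 b.
rewrite -a'E -b'E !kfn !iter_zip_shift_neg; congr tau; apply: kN.
by apply/(agree_iter_adding_machine _ n.+1); rewrite a'E b'E.
Qed.
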